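(* Let $H_1$ and $H_2$ be complex Hilbert spaces. For every semigroup $\mathcal S\subset B(H_1)$ and every unitary operator $U\in B(H_1,H_2)$, $\mathcal S$ is an SI semigroup if and only if $U\mathcal SU^*=\{USU^*: S\in\mathcal S\}$ is an SI semigroup in $B(H_2)$. Additionally, $\mathcal S$ is simple if and only if $U\mathcal SU^*$ is simple.
   Context: $B(H)$ is the set of bounded linear operators on $H$ (finite or infinite dimensional), $B(H_1,H_2)$ the bounded linear operators from $H_1$ to $H_2$. A semigroup $\mathcal S\subset B(H)$ is a subset closed under multiplication. An ideal $J$ of a semigroup $\mathcal S$ is a (two-sided) multiplicative ideal: a subset $J\subset\mathcal S$ with $XA, AX\in J$ for all $A\in J$, $X\in\mathcal S$ (no closure under sums or scalars is required). $\mathcal S$ is a selfadjoint-ideal (SI) semigroup if every ideal $J$ of $\mathcal S$ satisfies $\{A^*: A\in J\}\subset J$. $\mathcal S$ is simple if its only nonzero ideal (i.e. ideal containing a nonzero operator) is $\mathcal S$ itself; $\mathcal S$ may or may not contain $0$. *)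

(* Defs.v *)
From HB Require Import structures.
From mathcomp Require Import all_boot all_order all_algebra.
From mathcomp Require Import ring lra.
From mathcomp Require Import sesquilinear complex interval_inference.
From mathcomp Require Import all_classical all_reals topology normedtype.

Set Implicit Arguments.
Unset Strict Implicit.
Unset Printing Implicit Defensive.

Import Order.TTheory GRing.Theory Num.Theory.
Import numFieldNormedType.Exports.

Local Open Scope classical_set_scope.
Local Open Scope ring_scope.
Local Open Scope complex_scope.

(* [inner] is linear in its first argument and conjugate-linear in its second. *)
HB.mixin Record CompleteNormedModule_isHilbert (R : realType) (H : Type)
    of CompleteNormedModule R[i] H := {
  inner : {dot H for @Num.conj R[i]} ;
  inner_normE : forall x : H, inner x x = `|x| ^+ 2
}.

#[short(type="hilbertType")]
HB.structure Definition Hilbert (R : realType) :=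
  { H of CompleteNormedModule_isHilbert R H & CompleteNormedModule R[i] H }.

Record bop (R : realType) (H1 H2 : hilbertType R) := BOp {
  bop_linear :> {linear H1 -> H2} ;
  bop_bounded : exists M : R, forall x, `|bop_linear x| <= M%:C * `|x|
}.

Section InnerTheory.
Context {R : realType} {H : hilbertType R}.
Implicit Types (x y z : H) (t : R).

Let rin x y : R := complex.Re (inner x y).
Let rnorm x : R := complex.Re `|x|.

Let ReD (a b : R[i]) : complex.Re (a + b) = complex.Re a + complex.Re b.
Proof. by case: a b => [? ?] [? ?]. Qed.

Let ReZ t (a : R[i]) : complex.Re (t%:C * a) = t * complex.Re a.
Proof. by case: a => [? ?] /=; rewrite mul0r subr0. Qed.

Lemma inner_conj x y : inner x y = (inner y x)^*%R.
Proof. by rewrite hermitian_subproof expr0 mul1r. Qed.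

Lemma innerDl x y z : inner (x + y) z = inner x z + inner y z.
Proof. exact: linearDl. Qed.

Lemma innerZl (a : R[i]) x z : inner (a *: x) z = a * inner x z.
Proof. exact: linearZl_LR. Qed.

Lemma innerDr x y z : inner z (x + y) = inner z x + inner z y.
Proof. by rewrite inner_conj innerDl rmorphD /= -!inner_conj. Qed.

Lemma innerZr (a : R[i]) x z : inner z (a *: x) = a^*%R * inner z x.
Proof. by rewrite inner_conj innerZl rmorphM /= -inner_conj. Qed.

Lemma innerBr x y z : inner z (x - y) = inner z x - inner z y.
Proof. by rewrite -scaleN1r innerDr innerZr rmorphN rmorph1 mulN1r. Qed.

Lemma inner_injr y z : (forall x, inner x y = inner x z) -> y = z.
Proof.
move=> h; apply/eqP; rewrite -subr_eq0 -normr_eq0 -sqrf_eq0 -inner_normE.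
by rewrite innerBr h subrr.
Qed.

Let rnormE x : `|x| = (rnorm x)%:C.
Proof. by rewrite /rnorm RRe_real ?normr_real. Qed.

Let rnorm_ge0 x : 0 <= rnorm x.
Proof. by have := normr_ge0 x; rewrite rnormE lecR. Qed.

Let rinxx x : rin x x = rnorm x ^+ 2.
Proof. by rewrite /rin inner_normE rnormE -rmorphXn. Qed.

Let rinC x y : rin x y = rin y x.
Proof. by rewrite /rin inner_conj; case: (inner y x). Qed.

Let rinDl x y z : rin (x + y) z = rin x z + rin y z.
Proof. by rewrite /rin innerDl ReD. Qed.

Let rinDr x y z : rin z (x + y) = rin z x + rin z y.
Proof. by rewrite /rin innerDr ReD. Qed.

Let rinZl t x z : rin (t%:C *: x) z = t * rin x z.
Proof. by rewrite /rin innerZl ReZ. Qed.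

Let rinZr t x z : rin z (t%:C *: x) = t * rin z x.
Proof. by rewrite rinC rinZl rinC. Qed.

Let rin_cs x y : `|rin x y| <= rnorm x * rnorm y.
Proof.
have [-> | x0] := eqVneq x 0.
  by rewrite /rin linear0l normr0 mulr_ge0.
have [-> | y0] := eqVneq y 0.
  by rewrite rinC /rin linear0l normr0 mulr_ge0.
have px : 0 < rnorm x by have := x0; rewrite -normr_gt0 rnormE ltcR.
have py : 0 < rnorm y by have := y0; rewrite -normr_gt0 rnormE ltcR.
have pxy : 0 < rnorm x * rnorm y by rewrite mulr_gt0.
have key s : s ^+ 2 = 1 -> 0 <= rnorm x * rnorm y + s * rin x y.
  move=> s2.
  have : 0 <= rin ((rnorm y)%:C *: x + (s * rnorm x)%:C *: y)
                  ((rnorm y)%:C *: x + (s * rnorm x)%:C *: y).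
    by rewrite rinxx sqr_ge0.
  rewrite !rinDl !rinDr !rinZl !rinZr !rinxx (rinC y x) => h.
  have p2 : 0 < 2 * (rnorm x * rnorm y) by rewrite mulr_gt0.
  rewrite -(pmulr_rge0 _ p2); apply: le_trans h _.
  have -> : 2 * (rnorm x * rnorm y) * (rnorm x * rnorm y + s * rin x y) =
      (1 + 1) * (rnorm x * rnorm y) ^+ 2 + 2 * s * rnorm x * rnorm y * rin x y.
    by ring.
  by rewrite -{2}s2 le_eqVlt; apply/orP; left; apply/eqP; ring.
have h1 := key 1 (expr1n _ _).
have /key h2 : (-1 : R) ^+ 2 = 1 by rewrite sqrrN expr1n.
by rewrite ler_norml; apply/andP; split; lra.
Qed.

Lemma inner_le x y : `|inner x y| <= `|x| * `|y|.
Proof.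
have [-> | w0] := eqVneq (inner x y) 0; first by rewrite normr0 mulr_ge0.
have p : 0 < `|inner x y| by rewrite normr_gt0.
rewrite -(ler_pM2l p) -expr2 mulrA.
have -> : `|inner x y| * `|x| = `|(inner x y)^*%R *: x|.
  by rewrite normrZ norm_conjC.
have := le_trans (ler_norm _) (rin_cs ((inner x y)^*%R *: x) y).
rewrite -lecR rmorphM /= -!rnormE /rin innerZl mulrC -normCK.
by rewrite RRe_real // realX // normr_real.
Qed.

Lemma riesz_repr (f : H -> R[i]) (M : R) :
    (forall a x y, f (a *: x + y) = a * f x + f y) ->
    (forall x, `|f x| <= M%:C * `|x|) ->
  exists z, forall x, f x = inner x z.
Proof.
move=> flin fM.
pose rf x := complex.Re (f x).
have f0 : f 0 = 0 by have := flin (-1) 0 0; rewrite scaler0 addr0 mulN1r addNr.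
have fZ a x : f (a *: x) = a * f x by rewrite -[a *: x]addr0 flin f0 addr0.
have fD x y : f (x + y) = f x + f y by rewrite -[x in LHS]scale1r flin mul1r.
have rfD x y : rf (x + y) = rf x + rf y by rewrite /rf fD ReD.
have rfZ t x : rf (t%:C *: x) = t * rf x by rewrite /rf fZ ReZ.
have rfM x : rf x <= M * rnorm x.
  apply: le_trans (ler_norm _) _.
  have := le_trans (normc_ge_Re (f x)) (fM x).
  by rewrite rnormE -rmorphM /= lecR.
pose g x := rin x x - 2 * rf x.
have g_lb x : - M ^+ 2 <= g x.
  have h := rfM x; have h2 := sqr_ge0 (rnorm x - M).
  by rewrite /g rinxx; nra.
have hG : has_inf (range g).
  split; first by exists (g 0), 0.
  by exists (- M ^+ 2) => _ [x _ <-].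
pose m := inf (range g).
have m_le x : m <= g x.
  by apply: ge_inf; [case: hG | exists x].
pose e (n : nat) : R := n.+1%:R^-1.
have e_gt0 n : 0 < e n by rewrite /e invr_gt0.
have [u uP] : {u : nat -> H & forall n, g (u n) < m + e n}.
  apply: (@choice _ _ (fun n x => g x < m + e n)) => n.
  have [_ [x _ <-] h] := inf_adherent (e_gt0 n) hG.
  by exists x.
have para x y : rnorm (x - y) ^+ 2 <= 2 * (g x - m + (g y - m)).
  have h := m_le ((2^-1)%:C *: (x + y)).
  rewrite -rinxx -[- y]scaleN1r (_ : -1 = (-1 : R)%:C); last by rewrite rmorphN rmorph1.
  have : g ((2^-1)%:C *: (x + y)) = 4^-1 * (rin x x + 2 * rin x y + rin y y)
      - (rf x + rf y).
    rewrite /g rinZl rinZr !(rinDl, rinDr) rfZ rfD (rinC y x).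
    by field.
  rewrite !(rinDl, rinDr, rinZl, rinZr) (rinC y x) => hg; rewrite hg in h.
  rewrite /g; lra.
have le_e N n : (N <= n)%N -> e n <= e N.
  by move=> Nn; rewrite /e lef_pV2 ?posrE // ler_nat ltnS.
have small (d : R) : 0 < d -> exists N, e N < d.
  move=> /posnumP[d']; have [N _ hN] := near_infty_natSinv_lt d'.
  by exists N; exact: (hN N (leqnn N)).
have posC (d : R[i]) : 0 < d -> exists2 d' : R, 0 < d' & d = d'%:C.
  move=> d0; exists (complex.Re d).
    by move: d0; rewrite ltcE => /andP[].
  by rewrite RRe_real // gtr0_real.
have cu : cvg (u @ \oo).
  apply/cauchy_cvgP/cauchyP => _ /posC[d d0 ->].
  have [N hN] := small (d ^+ 2 / 4) (divr_gt0 (exprn_gt0 _ d0) (ltr0Sn _ 3)).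
  exists (u N), N => // n /= Nn.
  rewrite -ball_normE /= rnormE ltcR.
  rewrite -(ltr_pXn2r (n:=2)) ?nnegrE ?(ltW d0) //.
  apply: le_lt_trans (para _ _) _.
  have := uP N; have := uP n; have := le_e _ _ Nn; lra.
have [z uz] : exists z, u @ \oo --> z by exists (lim (u @ \oo)).
have small_dist n (d : R) : 0 < d ->
    exists k, (n <= k)%N /\ rnorm (z - u k) < d.
  move=> d0.
  have /cvgrPdist_lt /(_ d%:C) := uz.
  rewrite ltcR => /(_ d0) [N _ hN].
  exists (maxn n N); split; first exact: leq_maxl.
  have := hN (maxn n N) (leq_maxr _ _) => /=.
  by rewrite rnormE ltcR.
have var v t : 0 <= 2 * t * (rin z v - rf v) + t ^+ 2 * rin v v.
  apply/ler_addgt0Pr => d d0.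
  have [N hN] := small (d / 2) (divr_gt0 d0 (ltr0Sn _ 1)).
  pose c := 4 * `|t| * rnorm v + 1.
  have c0 : 0 < c.
    have h : 0 <= `|t| * rnorm v by rewrite mulr_ge0.
    by rewrite /c; lra.
  have [k [Nk hk]] := small_dist N (d / c) (divr_gt0 d0 c0).
  have h1 := m_le (u k + t%:C *: v).
  have h2 := uP k.
  have h3 := le_e _ _ Nk.
  have h4 : `|2 * t * rin (z - u k) v| <= d / 2.
    rewrite !normrM gtr0_norm // -mulrA.
    have h : `|t| * `|rin (z - u k) v| <= `|t| * (d / c * rnorm v).
      apply: ler_wpM2l => //; apply: le_trans (rin_cs _ _) _.
      by apply: ler_wpM2r => //; exact: ltW.
    have h' : 4 * (`|t| * (d / c * rnorm v)) <= d.
      rewrite (_ : 4 * _ = (c - 1) / c * d); last by rewrite /c; ring.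
      rewrite ler_piMl ?(ltW d0) // ler_pdivrMr // mul1r; lra.
    lra.
  have h5 : rin z v = rin (z - u k) v + rin (u k) v by rewrite -rinDl subrK.
  have h6 : g (u k + t%:C *: v) =
      g (u k) + 2 * t * (rin (u k) v - rf v) + t ^+ 2 * rin v v.
    by rewrite /g !(rinDl, rinDr, rinZl, rinZr) rfD rfZ (rinC v); ring.
  rewrite h5.
  move: h4; rewrite ler_norml => /andP[h4 _].
  rewrite h6 in h1.
  set p := rin (z - u k) v in h4 *; set q := rin (u k) v in h1 *.
  have -> : 2 * t * (p + q - rf v) = 2 * t * p + 2 * t * (q - rf v) by ring.
  lra.
have reE v : rf v = rin z v.
  pose D := rin z v - rf v.
  suff : D = 0 by move/subr0_eq.
  pose c := rin v v.
  have c0 : 0 <= c by rewrite /c rinxx sqr_ge0.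
  have c1 : 0 < c + 1 by lra.
  have := var v (- D / (c + 1)); rewrite -/D -/c.
  rewrite (_ : _ + _ = - (D ^+ 2 * ((c + 2) / (c + 1) ^+ 2))); last first.
    by field; rewrite gt_eqF.
  rewrite oppr_ge0 pmulr_lle0; last by rewrite divr_gt0 ?exprn_gt0 //; lra.
  by move=> h; apply/eqP; rewrite -sqrf_eq0 eq_le h sqr_ge0.
exists z => x; apply/eqP; rewrite eq_complex; apply/andP; split; apply/eqP.
  by rewrite -/(rf x) reE rinC.
have := reE ('i%C *: x); rewrite rinC /rf /rin fZ innerZl.
by rewrite mulrC ReiNIm mulrC ReiNIm => /oppr_inj.
Qed.

End InnerTheory.

Section BoundedOperators.
Context {R : realType}.
Implicit Types H : hilbertType R.

Lemma bopP H1 H2 (A B : bop H1 H2) : A =1 B -> A = B.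
Proof.
case: A B => [A bA] [B bB] /= AB.
have {}AB : A = B.
  case: A B AB {bA bB} => f [[fD] [fZ]] [g [[gD] [gZ]]] /= /funext fg.
  case: g / fg gD gZ => gD gZ.
  by rewrite (Prop_irrelevance fD gD) (Prop_irrelevance fZ gZ).
by case: B / AB bB => bB; congr BOp; exact: Prop_irrelevance.
Qed.

Lemma bop0_bounded H1 H2 :
  exists M : R, forall x : H1, `|(\0 : H1 -> H2) x| <= M%:C * `|x|.
Proof. by exists 0 => x; rewrite normr0 mul0r. Qed.

Definition bop0 H1 H2 : bop H1 H2 := BOp (@bop0_bounded H1 H2).

Lemma bop1_bounded H : exists M : R, forall x : H, `|idfun x| <= M%:C * `|x|.
Proof. by exists 1 => x; rewrite mul1r. Qed.

Definition bop1 H : bop H H := BOp (@bop1_bounded H).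

Lemma bop_comp_bounded H1 H2 H3 (A : bop H2 H3) (B : bop H1 H2) :
  exists M : R, forall x, `|(A \o B) x| <= M%:C * `|x|.
Proof.
have [M AM] := bop_bounded A; have [N BN] := bop_bounded B.
exists (`|M| * N) => x; apply: le_trans (AM _) _.
apply: (@le_trans _ _ (`|M|%:C * `|B x|)).
  by apply: ler_wpM2r => //; rewrite lecR ler_norm.
by rewrite rmorphM /= -mulrA; apply: ler_wpM2l; rewrite ?lecR.
Qed.

Definition bop_comp H1 H2 H3 (A : bop H2 H3) (B : bop H1 H2) : bop H1 H3 :=
  BOp (bop_comp_bounded A B).

Lemma adjoint_exists H1 H2 (A : bop H1 H2) :
  exists B : bop H2 H1, forall x y, inner (A x) y = inner x (B y).
Proof.
have [M0 AM0] := bop_bounded A.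
pose M := `|M0|; have M_ge0 : 0 <= M by exact: normr_ge0.
have AM x : `|A x| <= M%:C * `|x|.
  apply: le_trans (AM0 x) _.
  by apply: ler_wpM2r => //; rewrite lecR ler_norm.
have [B BP] : {B : H2 -> H1 & forall y x, inner (A x) y = inner x (B y)}.
  apply: (@choice _ _ (fun y z => forall x, inner (A x) y = inner x z)) => y.
  apply: (@riesz_repr _ _ _ (M * complex.Re `|y|)) => [a x x'|x].
    by rewrite linearP innerDl innerZl.
  apply: le_trans (inner_le _ _) _.
  rewrite rmorphM /= RRe_real ?normr_real // mulrAC.
  exact: ler_wpM2r.
have Blin : linear B.
  move=> a y y'; apply: inner_injr => x.
  by rewrite -BP innerDr innerZr !BP -innerZr -innerDr.
have Bbd y : `|B y| <= M%:C * `|y|.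
  have [-> | By0] := eqVneq (B y) 0; first by rewrite normr0 mulr_ge0 ?lecR.
  have p : 0 < `|B y| by rewrite normr_gt0.
  rewrite -(ler_pM2l p) -expr2 -inner_normE -BP.
  apply: (@le_trans _ _ `|inner (A (B y)) y|).
    by rewrite BP inner_normE normrX normr_id.
  apply: le_trans (inner_le _ _) _.
  by rewrite mulrA [_ * M%:C]mulrC; apply: ler_wpM2r.
pose Bl : {linear H2 -> H1} :=
  HB.pack B (GRing.isLinear.Build _ _ _ _ B Blin).
have Blbd : exists N : R, forall y, `|Bl y| <= N%:C * `|y| by exists M.
by exists (BOp Blbd) => x y; rewrite BP.
Qed.

Definition adjoint H1 H2 (A : bop H1 H2) : bop H2 H1 :=
  projT1 (cid (adjoint_exists A)).

Lemma adjointP H1 H2 (A : bop H1 H2) x y :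
  inner (A x) y = inner x (adjoint A y).
Proof. exact: (projT2 (cid (adjoint_exists A))). Qed.

Definition unitary H1 H2 (U : bop H1 H2) :=
  bop_comp (adjoint U) U = bop1 H1 /\ bop_comp U (adjoint U) = bop1 H2.

Definition conjugate H1 H2 (U : bop H1 H2) (S : set (bop H1 H1)) :
    set (bop H2 H2) :=
  [set bop_comp (bop_comp U A) (adjoint U) | A in S].

Definition semigroup H (S : set (bop H H)) :=
  forall A B, S A -> S B -> S (bop_comp A B).

Definition ideal H (S J : set (bop H H)) :=
  J `<=` S /\
  forall A X, J A -> S X -> J (bop_comp X A) /\ J (bop_comp A X).

Definition SI_semigroup H (S : set (bop H H)) :=
  semigroup S /\
  forall J, ideal S J -> [set adjoint A | A in J] `<=` J.

Definition simple_semigroup H (S : set (bop H H)) :=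
  semigroup S /\
  forall J, ideal S J -> (exists2 A, J A & A <> bop0 H H) -> J = S.

End BoundedOperators.

(* Main.v *)
Require Import Defs.
From mathcomp Require Import all_boot all_order all_algebra.
From mathcomp Require Import all_classical all_reals.

Set Implicit Arguments.
Unset Strict Implicit.
Unset Printing Implicit Defensive.

Local Open Scope classical_set_scope.

(** For unitary [U], the map [A |-> U A U^*] is a bijective *-homomorphism with
    inverse the conjugation by [U^*]. Hence it carries ideals of [S] to ideals
    of [U S U^*], and both properties transfer from [S] to [U S U^*]; the
    converses are the same implications for the unitary [U^*]. *)

Section Conjugation.
Context {R : realType}.
Implicit Types H : hilbertType R.

Lemma bop_compA H1 H2 H3 H4 (A : bop H3 H4) (B : bop H2 H3) (C : bop H1 H2) :
  bop_comp A (bop_comp B C) = bop_comp (bop_comp A B) C.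
Proof. exact: bopP. Qed.

Lemma bop_comp1l H1 H2 (A : bop H1 H2) : bop_comp (bop1 H2) A = A.
Proof. exact: bopP. Qed.

Lemma bop_comp1r H1 H2 (A : bop H1 H2) : bop_comp A (bop1 H1) = A.
Proof. exact: bopP. Qed.

Lemma bop_comp0l H1 H2 H3 (A : bop H1 H2) :
  bop_comp (bop0 H2 H3) A = bop0 H1 H3.
Proof. exact: bopP. Qed.

Lemma bop_comp0r H1 H2 H3 (A : bop H2 H3) :
  bop_comp A (bop0 H1 H2) = bop0 H1 H3.
Proof. by apply: bopP => x; exact: GRing.linear0. Qed.

(** The inner product separates points in its second argument. As [adjoint] is obtained by choice,
    all adjoints below are computed through this characterization. *)
Lemma adjoint_unique H1 H2 (A : bop H1 H2) (B : bop H2 H1) :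
  (forall x y, inner (A x) y = inner x (B y)) -> adjoint A = B.
Proof.
by move=> AB; apply: bopP => y; apply: inner_injr => x; rewrite -adjointP.
Qed.

Lemma adjointK H1 H2 (A : bop H1 H2) : adjoint (adjoint A) = A.
Proof.
by apply: adjoint_unique => x y; rewrite inner_conj -adjointP -inner_conj.
Qed.

Lemma adjoint_comp H1 H2 H3 (A : bop H2 H3) (B : bop H1 H2) :
  adjoint (bop_comp A B) = bop_comp (adjoint B) (adjoint A).
Proof. by apply: adjoint_unique => x y; rewrite /= !adjointP. Qed.

Lemma unitary_adjoint H1 H2 (U : bop H1 H2) : unitary U -> unitary (adjoint U).
Proof. by case=> UU' U'U; split; rewrite adjointK. Qed.

(** Names the map whose image of [S] is [conjugate U S], so that cancellation and injectivity can be
    stated for it. *)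
Definition conj_bop H1 H2 (U : bop H1 H2) (A : bop H1 H1) : bop H2 H2 :=
  bop_comp (bop_comp U A) (adjoint U).

Lemma conj_bop_adjoint H1 H2 (U : bop H1 H2) (A : bop H1 H1) :
  adjoint (conj_bop U A) = conj_bop U (adjoint A).
Proof. by rewrite /conj_bop !adjoint_comp adjointK bop_compA. Qed.

Lemma conj_bop0 H1 H2 (U : bop H1 H2) : conj_bop U (bop0 H1 H1) = bop0 H2 H2.
Proof. by rewrite /conj_bop bop_comp0r bop_comp0l. Qed.

Lemma conj_bop_comp H1 H2 (U : bop H1 H2) (A B : bop H1 H1) : unitary U ->
  conj_bop U (bop_comp A B) = bop_comp (conj_bop U A) (conj_bop U B).
Proof.
(* With everything associated to the right, both sides start with [U] and [A]; what remains is to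
   cancel [U^* U] in front of [B U^*]. *)
case=> U'U _; rewrite /conj_bop -!bop_compA; do 2 congr bop_comp.
by rewrite (bop_compA (adjoint U)) U'U bop_comp1l.
Qed.

Lemma conj_bopK H1 H2 (U : bop H1 H2) : unitary U ->
  cancel (conj_bop U) (conj_bop (adjoint U)).
Proof.
case=> U'U _ A; rewrite /conj_bop adjointK -!bop_compA U'U bop_comp1r.
by rewrite bop_compA U'U bop_comp1l.
Qed.

Lemma conj_bop_inj H1 H2 (U : bop H1 H2) : unitary U -> injective (conj_bop U).
Proof. by move=> /conj_bopK /can_inj. Qed.

Lemma conjugateK H1 H2 (U : bop H1 H2) (S : set (bop H1 H1)) : unitary U ->
  conjugate (adjoint U) (conjugate U S) = S.
Proof.
move=> /conj_bopK UK; apply/seteqP; split=> [_ [_ [A SA <-] <-]|A SA].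
  by rewrite -/(conj_bop U A) -/(conj_bop (adjoint U) _) UK.
by exists (conj_bop U A); [exists A | exact: UK].
Qed.

Lemma semigroup_conjugate H1 H2 (U : bop H1 H2) (S : set (bop H1 H1)) :
  unitary U -> semigroup S -> semigroup (conjugate U S).
Proof.
move=> uU Ssg _ _ [A SA <-] [B SB <-].
by exists (bop_comp A B); [exact: Ssg | exact: conj_bop_comp].
Qed.

Lemma ideal_conjugate H1 H2 (U : bop H1 H2) (S J : set (bop H1 H1)) :
  unitary U -> ideal S J -> ideal (conjugate U S) (conjugate U J).
Proof.
move=> uU [JS Jid]; split; first exact: image_subset.
move=> _ _ [A JA <-] [X SX <-]; have [JXA JAX] := Jid A X JA SX.
split; first by exists (bop_comp X A) => //; exact: conj_bop_comp.
by exists (bop_comp A X) => //; exact: conj_bop_comp.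
Qed.

(** Pulls an ideal of [U S U^*] back to [S], where the hypotheses on ideals of [S] apply. *)
Lemma ideal_conjugate_adjoint H1 H2 (U : bop H1 H2) (S : set (bop H1 H1))
    (J : set (bop H2 H2)) :
  unitary U -> ideal (conjugate U S) J -> ideal S (conjugate (adjoint U) J).
Proof.
move=> uU /(ideal_conjugate (unitary_adjoint uU)).
by rewrite (conjugateK _ uU).
Qed.

Lemma SI_semigroup_conjugate H1 H2 (U : bop H1 H2) (S : set (bop H1 H1)) :
  unitary U -> SI_semigroup S -> SI_semigroup (conjugate U S).
Proof.
move=> uU [Ssg SI]; split; first exact: semigroup_conjugate.
move=> J /(ideal_conjugate_adjoint uU) /SI J'adj _ [A JA <-].
(* Since [U^* J U] is selfadjoint, [(U^* A U)^* = U^* B U] for some [B] in [J]; injectivity of the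
   conjugation then gives [B = A^*]. *)
have [|B JB] := J'adj (adjoint (conj_bop (adjoint U) A)).
  by exists (conj_bop (adjoint U) A) => //; exists A.
rewrite conj_bop_adjoint => /(conj_bop_inj (unitary_adjoint uU)) <-.
exact: JB.
Qed.

Lemma simple_semigroup_conjugate H1 H2 (U : bop H1 H2) (S : set (bop H1 H1)) :
  unitary U -> simple_semigroup S -> simple_semigroup (conjugate U S).
Proof.
move=> uU [Ssg simS]; split; first exact: semigroup_conjugate.
have uU' := unitary_adjoint uU.
move=> J /(ideal_conjugate_adjoint uU) /simS J'S [A JA A0].
(* Once [U^* J U = S], conjugating back by [U], read as [U^**], recovers [J]. *)
rewrite -J'S; first by rewrite -{1}[U]adjointK conjugateK.
exists (conj_bop (adjoint U) A); first by exists A.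
(* The pulled-back ideal is nonzero: [U^* A U = 0 = U^* 0 U] would force [A = 0]. *)
by rewrite -(conj_bop0 (adjoint U)) => /(conj_bop_inj uU').
Qed.

End Conjugation.

Theorem theorem1p21 (R : realType) (H1 H2 : hilbertType R)
    (S : set (bop H1 H1)) (U : bop H1 H2) :
  semigroup S -> unitary U ->
  (SI_semigroup S <-> SI_semigroup (conjugate U S)) /\
  (simple_semigroup S <-> simple_semigroup (conjugate U S)).
Proof.
move=> _ uU; have uU' := unitary_adjoint uU.
split; split.
- exact: SI_semigroup_conjugate.
- by move=> /(SI_semigroup_conjugate uU'); rewrite conjugateK.
- exact: simple_semigroup_conjugate.
- by move=> /(simple_semigroup_conjugate uU'); rewrite conjugateK.
Qed.
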